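(* Let $A$ be a primitive $N\times N$-matrix with entries in $\{0,1\}$. There are constants $0<C_0\le C_1$ such that for every non-empty admissible finite word $\beta$ and every eigenvalue $\lambda_\beta^A(\nu)$ (described in the context) of the logarithmic Dirichlet Laplacian $\Delta_{C(\beta)}$ it holds that $$C_0(|\nu|-|\beta|)\le\lambda_\beta^A(\nu)\le C_1(|\nu|-|\beta|).$$
   Context: $A$ is primitive if some power of $A$ has all entries positive. A finite word $\nu=\nu_1\cdots\nu_n$ in the alphabet $\{1,\dots,N\}$ is admissible if $A_{\nu_i,\nu_{i+1}}=1$ for all $i$; $|\nu|=n$ is its length. $\lambda_{\max}>1$ is the Perron--Frobenius eigenvalue of $A$, and $u,v$ are Perron--Frobenius eigenvectors with positive entries of $A$ and $A^T$ respectively, normalised by $\sum_iu_iv_i=1$. Put $P_{i,j}=\frac{A_{i,j}u_j}{\lambda_{\max}u_i}$. $\Sigma_A$ is the space of infinite admissible words with the metric $\mathrm d(x,y)=\lambda^{-\inf\{n-1:x_n\ne y_n\}}$ for a fixed $\lambda>1$, $C(\beta)\subseteq\Sigma_A$ is the cylinder set of infinite words starting with $\beta$, and $\mu$ is the Parry measure, $\mu(C(\alpha))=v_{\alpha_1}u_{\alpha_n}\lambda_{\max}^{-(n-1)}$ for admissible $\alpha$ of length $n\ge1$. With $\delta=\log_\lambda(\lambda_{\max})$, $\Delta_{C(\beta)}$ is the logarithmic Dirichlet Laplacian on $L^2(C(\beta),\mu)$, the positive self-adjoint closure of $\Delta_{C(\beta)}f(x)=\int_{C(\beta)}\frac{f(x)-f(y)}{\mathrm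 d(x,y)^\delta}\,\mathrm d\mu(y)$ on locally constant functions $f$. The operator $\Delta_{C(\beta)}$ has an orthonormal eigenbasis consisting of the normalised constant function $h_\beta=\mu(C(\beta))^{-1/2}\chi_{C(\beta)}$, which spans its kernel, and functions $h_{\nu,j}$, where $\nu=\beta\nu_0$ ranges over the admissible words starting with $\beta$ (including $\nu=\beta$) for which $\#\{i\in\{1,\dots,N\}:A_{\nu_{|\nu|},i}=1\}\ge2$, and $j$ ranges over an index set $J_\beta(\nu)\subseteq\{1,\dots,N\}$ with $\#\{i:A_{\nu_{|\nu|},i}=1\}-1$ elements. The function $h_{\nu,j}$ is supported in $C(\nu)$, has mean zero, and is constant on $C(\eta)$ for all words $\eta$ with $|\eta|\ge|\nu|+1$. The eigenvalues are given by $\Delta_{C(\beta)}h_{\nu,j}=\lambda_\beta^A(\nu)h_{\nu,j}$, where $\lambda_\beta^A(\nu)=1$ if $C(\nu)=C(\beta)$, and if $C(\nu)\subsetneq C(\beta)$ then $$\lambda_\beta^A(\nu)=1+\lambda_{\max}v_{\nu_1}\sum_{k=0}^{|\nu|-|\beta|-1}u_{\nu_{|\nu|-k-1}}\bigl(1-P_{\nu_{|\nu|-k-1},\nu_{|\nu|-k}}\bigr).$$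
   Formalization: The upper bound is claimed only for ν ≠ β, since for ν = β one has |ν|−|β| = 0 while the eigenvalue is 1; the lower bound is kept for all ν, and both bounds are proved for the closed formula and for the eigenvalue of the integral operator. *)

(* Defs.v *)
From HB Require Import structures.
From mathcomp Require Import all_boot all_order all_algebra.
From mathcomp Require Import all_classical all_reals all_analysis.

Set Implicit Arguments.
Unset Strict Implicit.
Unset Printing Implicit Defensive.
Import Order.TTheory GRing.Theory Num.Theory.
Import numFieldNormedType.Exports.

Local Open Scope classical_set_scope.
Local Open Scope ring_scope.

(* The alphabet {1, ..., N} is 'I_N with N = n.+1. All indices are 0-based: the
   k-th letter (k >= 1) of a word w is nth ord0 w k.-1, and the k-th letter of
   an infinite word x is x k.-1. *)
Definition word (n : nat) := seq 'I_n.+1.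
Definition iword (n : nat) := nat -> 'I_n.+1.

HB.instance Definition _ (n : nat) := Choice.copy (iword n) (nat -> 'I_n.+1).
HB.instance Definition _ (n : nat) := isPointed.Build (iword n) (fun=> ord0).

Section Shift.
Variables (R : realType) (n : nat) (A : 'M[R]_n.+1).
Implicit Types (w beta nu eta : word n) (i j : 'I_n.+1).

Definition zero_one := forall i j, A i j = 0 \/ A i j = 1.

Definition primitive := exists k, (0 < k)%N /\ forall i j, 0 < (A ^+ k) i j.

Definition admissible w : bool := sorted (fun i j => A i j == 1) w.

(* The infinite admissible words, as a subset of all infinite words. *)
Definition Sigma_A : set (iword n) := [set x | forall k, A (x k) (x k.+1) = 1].

Definition cylinder w : set (iword n) :=
  [set x | Sigma_A x /\ mkseq x (size w) = w].

(* The sigma-algebra is generated by the cylinder sets; its trace on Sigma_A is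
   the Borel sigma-algebra, and the complement of Sigma_A is an atom. *)
Definition cylinder_sets : set (set (iword n)) := range cylinder.

Definition path_space := g_sigma_algebraType cylinder_sets.

Definition successors i : {set 'I_n.+1} := [set j | A i j == 1].

(* The words nu indexing the nonzero part of the spectrum on C(beta), for beta
   nonempty. *)
Definition spectral_word beta nu : Prop :=
  [/\ prefix beta nu, admissible nu &
      (2 <= #|successors (last ord0 nu)|)%N].

End Shift.

Section PerronFrobenius.
Variables (R : realType) (n : nat) (A : 'M[R]_n.+1).
Variables (lmax : R) (u v : 'cV[R]_n.+1).

(* By the Perron-Frobenius theorem, an eigenvalue of a primitive matrix with an
   entrywise positive eigenvector is the Perron-Frobenius eigenvalue. *)
Record perron_frobenius : Prop := PerronFrobenius {
  pf_right : A *m u = lmax *: u ;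
  pf_left : A^T *m v = lmax *: v ;
  pf_right_gt0 : forall i, 0 < u i 0 ;
  pf_left_gt0 : forall i, 0 < v i 0 ;
  pf_normalised : \sum_i u i 0 * v i 0 = 1 }.

Definition transition (i j : 'I_n.+1) : R := A i j * u j 0 / (lmax * u i 0).

(* The closed formula for lambda_beta^A(nu). In 1-based notation the letters
   nu_(|nu|-k-1) and nu_(|nu|-k) have 0-based positions |nu|-k-2 and |nu|-k-1;
   no subtraction truncates since beta is nonempty and k < |nu| - |beta|. *)
Definition lambda_formula (beta nu : word n) : R :=
  let l := nth ord0 nu in
  let m := size nu in
  if `[< cylinder A nu = cylinder A beta >] then 1 else
  1 + lmax * v (l 0%N) 0 *
      \sum_(0 <= k < m - size beta)
         u (l (m - k - 2)%N) 0 *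
         (1 - transition (l (m - k - 2)%N) (l (m - k - 1)%N)).

Variable mu : {measure set (path_space A) -> \bar R}.

Record parry_measure : Prop := ParryMeasure {
  parry_support : mu (~` Sigma_A A) = 0%E ;
  parry_cylinder : forall alpha : word n, admissible A alpha ->
    (1 <= size alpha)%N ->
    mu (cylinder A alpha) =
      (v (head ord0 alpha) 0 * u (last ord0 alpha) 0
         * lmax ^- (size alpha).-1)%:E }.

Variable lam : R.

(* In 0-based indexing the exponent inf {n - 1 | x_n != y_n} is the first
   position where x and y differ; it is infinite when x = y. *)
Definition dist (x y : iword n) : R :=
  if pselect (exists k, x k != y k) is left neq_xy
  then lam ^- ex_minn neq_xy else 0.

Definition dimension : R := ln lmax / ln lam.

(* Division by 0 gives 0, so the integrand vanishes at y = x. *)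
Definition laplacian (beta : word n) (f : iword n -> R) (x : iword n) : R :=
  (\int[mu]_(y in cylinder A beta) ((f x - f y) / (dist x y `^ dimension)))%R.

(* The functions spanned by the h_(nu,j) for fixed nu, without 0. They are
   locally constant, so the closure of the Laplacian acts on them by the
   integral formula. *)
Record wavelet (nu : word n) (h : iword n -> R) : Prop := Wavelet {
  wavelet_neq0 : exists x, h x != 0 ;
  wavelet_supp : forall x, ~ cylinder A nu x -> h x = 0 ;
  wavelet_mean0 : (\int[mu]_(x in cylinder A nu) h x)%R = 0 ;
  wavelet_const : forall eta : word n, (size nu + 1 <= size eta)%N ->
    forall x y, cylinder A eta x -> cylinder A eta y -> h x = h y }.

(* This value is obtained from lambda_formula (outside its first case) by
   replacing the summand 1 with lmax * v_(nu_1) * u_(nu_|nu|), so the two agree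
   only when that product is 1, as for the full shift. *)
Definition laplacian_eigenvalue (beta nu : word n) (ell : R) : Prop :=
  exists h : iword n -> R, wavelet nu h /\
    forall x, cylinder A beta x -> laplacian beta h x = ell * h x.

End PerronFrobenius.

(* Main.v *)
(* With m = |nu|, b = |beta| and S = sum_(b <= p < m) (u_(p-1) - u_p / lmax), where
   u_p is the value of u at the 0-based p-th letter of nu, both descriptions of the
   eigenvalue have the form c + lmax v_1 S with c bounded away from 0 and infinity:
   c = 1 for the closed formula, and c = lmax v_1 u_(m-1) for the integral operator,
   whose integrand at a point of C(nu) is a combination of indicators of the
   cylinders of the prefixes of nu and of the wavelet itself, which has mean 0.
   Individual terms of S may vanish, but lmax S is (lmax - 1) sum u_(p-1) plus a
   telescoping sum, hence at least a multiple of m - b minus a constant; the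
   positive c absorbs that constant. If C(nu) = C(beta), equality of the measures
   gives u_(m-1) = lmax^(m-b) u_(b-1), which bounds m - b. *)
Require Import Defs.
From HB Require Import structures.
From mathcomp Require Import all_boot all_order all_algebra.
From mathcomp Require Import all_classical all_reals all_analysis.
From mathcomp Require Import ring lra zify.

Set Implicit Arguments.
Unset Strict Implicit.
Unset Printing Implicit Defensive.
Import Order.TTheory GRing.Theory Num.Theory.

Local Open Scope classical_set_scope.
Local Open Scope ring_scope.

(** * Integrals with a prescribed value *)

Section IntegralValue.
Context {d : measure_display} {T : measurableType d} {R : realType}.
Variables (mu : {measure set T -> \bar R}) (D : set T).
Hypothesis mD : measurable D.
Implicit Types (f g : T -> R) (r s : R).

(** Integrability is bundled with the value because additivity of the real-valued integral requires
    it. *)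
Definition has_integral f r :=
  mu.-integrable D (EFin \o f) /\ \int[mu]_(x in D) f x = r.

Lemma has_integral_indic (E : set T) r :
  measurable E -> E `<=` D -> mu E = r%:E -> has_integral \1_E r.
Proof.
move=> mE ED muE.
have intE : (\int[mu]_(x in D) (\1_E x)%:E = r%:E)%E.
  by rewrite integral_indic// setIidl.
split; last by rewrite /Rintegral intE.
apply/integrableP; split.
  by apply/measurable_realfun.measurable_EFinP; exact: measurable_realfun.measurable_indic.
by rewrite integral_fin_num_abs ?intE//; exact: measurable_realfun.measurable_indic.
Qed.

Lemma has_integralZ f r c : has_integral f r -> has_integral (fun x => c * f x) (c * r).
Proof.
move=> [fi <-]; split; last by rewrite RintegralZl.
exact: (integrableZl mD c fi).
Qed.

Lemma has_integralD f g r s : has_integral f r -> has_integral g s ->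
  has_integral (fun x => f x + g x) (r + s).
Proof.
move=> [fi <-] [gi <-]; split; last by rewrite RintegralD.
exact: (integrableD mD fi gi).
Qed.

Lemma has_integral_sum (I : Type) (s : seq I) (P : pred I) (f : I -> T -> R)
    (r : I -> R) : (forall i, P i -> has_integral (f i) (r i)) ->
  has_integral (fun x => \sum_(i <- s | P i) f i x) (\sum_(i <- s | P i) r i).
Proof.
move=> fr; elim: s => [|i s [ih1 ih2]].
  split; last first.
    under eq_Rintegral do rewrite big_nil.
    by rewrite Rintegral_cst// mul0r big_nil.
  apply: eq_integrable (integrable0 mu D) => // x _ /=.
  by rewrite big_nil.
rewrite big_cons; under eq_fun do rewrite big_cons.
by case: ifPn => // /fr fri; exact: has_integralD.
Qed.

End IntegralValue.

(** * Cylinder sets, and wavelets as step functions *)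

Section Cylinders.
Variables (R : realType) (n : nat) (A : 'M[R]_n.+1).
Implicit Types (w beta nu eta : word n) (x y : iword n).

Lemma cylinder_nth w x : cylinder A w x <->
  Sigma_A A x /\ forall i, (i < size w)%N -> x i = nth ord0 w i.
Proof.
split=> -[Sx xw]; split=> //.
  by move=> i iw; rewrite -xw nth_mkseq.
apply: (@eq_from_nth _ ord0) => [|i]; rewrite size_mkseq// => iw.
by rewrite nth_mkseq// xw.
Qed.

Lemma cylinder_take nu p x : (p <= size nu)%N -> cylinder A (take p nu) x <->
  Sigma_A A x /\ forall i, (i < p)%N -> x i = nth ord0 nu i.
Proof.
move=> pnu; rewrite cylinder_nth size_takel//.
by split=> -[Sx h]; split=> // i ip; rewrite h// nth_take.
Qed.


Lemma subset_cylinder beta nu : prefix beta nu ->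
  cylinder A nu `<=` cylinder A beta.
Proof.
move=> /prefixP[s ->] x /cylinder_nth[Sx h]; apply/cylinder_nth; split=> // i ib.
by rewrite h ?nth_cat ?ib// size_cat ltn_addr.
Qed.

Lemma cylinder_rcons nu j x :
  cylinder A (rcons nu j) x <-> cylinder A nu x /\ x (size nu) = j.
Proof.
split.
  move=> xj; split; first exact: subset_cylinder (prefix_rcons _ _) _ xj.
  move/cylinder_nth: xj => [_ ->]; rewrite ?size_rcons//.
  by rewrite nth_rcons ltnn eqxx.
move=> [/cylinder_nth[Sx h] xj]; apply/cylinder_nth; split=> // i.
rewrite size_rcons ltnS leq_eqVlt nth_rcons => /predU1P[->|il].
  by rewrite ltnn eqxx.
by rewrite il h.
Qed.

Lemma measurable_cylinder w : @measurable _ (path_space A) (cylinder A w).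
Proof. by apply: sub_sigma_algebra; exists w. Qed.

(** The one-letter extensions of [nu] cut its cylinder into pieces on which [h] is constant, and [h]
    vanishes elsewhere. *)
Lemma wavelet_simple (mu : {measure set (path_space A) -> \bar R}) nu
    (h : iword n -> R) : wavelet mu nu h ->
  exists c : 'I_n.+1 -> R,
    forall y, h y = \sum_j c j * \1_(cylinder A (rcons nu j)) y.
Proof.
move=> [_ hsupp _ hconst].
(* [xget] returns junk on an empty cylinder, whose indicator vanishes anyway. *)
exists (fun j => h (xget (fun=> ord0) (cylinder A (rcons nu j)))) => y.
have [nuy|nuy] := pselect (cylinder A nu y); last first.
  rewrite hsupp// big1// => j _.
  by rewrite indicE memNset ?mulr0// => /cylinder_rcons[].
rewrite (bigD1 (y (size nu)))//= big1 => [|j jy]; last first.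
  by rewrite indicE memNset ?mulr0// => /cylinder_rcons[_ yj]; rewrite yj eqxx in jy.
have yC : cylinder A (rcons nu (y (size nu))) y by apply/cylinder_rcons.
rewrite addr0 indicE mem_set// mulr1.
apply: (hconst (rcons nu (y (size nu)))) => //; first by rewrite size_rcons addn1.
exact: xgetPex (ex_intro _ y yC).
Qed.

End Cylinders.

(** * The kernel of the Laplacian *)

Section Distance.
Variables (R : realType) (n : nat) (lmax lam : R).
Hypotheses (lmax1 : 1 < lmax) (lam1 : 1 < lam).

(** The dimension is chosen so that [lam] raised to it is [lmax]. *)
Lemma dist_dimensionV (x y : iword n) k : x k != y k ->
  (forall i, (i < k)%N -> x i = y i) ->
  (dist lam x y `^ dimension lmax lam)^-1 = lmax ^+ k.
Proof.
move=> xyk xyi; rewrite /dist; case: pselect => [e|]; last first.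
  by move=> ne; exfalso; apply: ne; exists k.
case: ex_minnP => m xym mmin.
have -> : m = k.
  apply/eqP; rewrite eqn_leq mmin//= leqNgt; apply/negP => /xyi xymE.
  by rewrite xymE eqxx in xym.
have lam0 : 0 < lam := lt_trans ltr01 lam1.
have lmax0 : 0 < lmax := lt_trans ltr01 lmax1.
have lnlam : ln lam != 0 by rewrite gt_eqF// ln_gt0.
rewrite /powR gt_eqF ?invr_gt0 ?exprn_gt0// -expRN lnV ?posrE ?exprn_gt0//.
rewrite lnXn// mulrN opprK mulrnAr /dimension divfK//.
by rewrite -mulr_natl expRM_natl lnK.
Qed.

End Distance.

(** * The eigenvalue of the integral operator *)

Section Spectrum.
Variables (R : realType) (n : nat) (A : 'M[R]_n.+1).
Variables (lmax : R) (u v : 'cV[R]_n.+1) (lam : R).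
Variable mu : {measure set (path_space A) -> \bar R}.
Hypotheses (lmax1 : 1 < lmax) (lam1 : 1 < lam).
Hypothesis muP : parry_measure lmax u v mu.
Variables beta nu : word n.
Hypotheses (beta0 : (0 < size beta)%N) (beta_nu : prefix beta nu).
Hypothesis nuA : admissible A nu.
Local Notation l := (nth ord0 nu).
Local Notation m := (size nu).

(* The sum of the closed formula, since [u_i (1 - P_ij) = u_i - u_j / lmax] when
   [A_ij = 1]; the index [p] is the 0-based position of the letter [j]. *)
Definition excess : R :=
  \sum_(size beta <= p < m) (u (l p.-1) 0 - u (l p) 0 / lmax).

Let lmax0 : 0 < lmax. Proof. exact: lt_trans ltr01 lmax1. Qed.

Let size_le : (size beta <= m)%N. Proof. exact: size_prefix. Qed.

Let beta_take : beta = take (size beta) nu.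
Proof. by apply/esym/eqP; rewrite -prefixE. Qed.

Lemma parry_take p : (0 < p <= m)%N ->
  mu (cylinder A (take p nu)) = (v (l 0%N) 0 * u (l p.-1) 0 * lmax ^- p.-1)%:E.
Proof.
move=> /andP[p0 pm].
rewrite (parry_cylinder muP) ?size_takel//; last exact: take_sorted.
by rewrite -nth0 -nth_last size_takel// !nth_take// prednK.
Qed.

Lemma has_integral_cylinder_take p : (size beta <= p <= m)%N ->
  has_integral mu (cylinder A beta) \1_(cylinder A (take p nu))
    (v (l 0%N) 0 * u (l p.-1) 0 * lmax ^- p.-1).
Proof.
move=> /andP[bp pm]; apply: has_integral_indic.
- exact: measurable_cylinder.
- exact: measurable_cylinder.
- apply: subset_cylinder; rewrite beta_take prefixE size_takel//.
  by rewrite take_takel.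
- by rewrite parry_take// pm (leq_trans beta0 bp).
Qed.

Lemma has_integral_wavelet h : wavelet mu nu h ->
  has_integral mu (cylinder A beta) h 0.
Proof.
move=> hW; have [c hc] := wavelet_simple hW.
(* The value does not depend on [D], so the zero mean over the cylinder of [nu] carries over to that
   of [beta]. *)
have intD D : measurable (D : set (path_space A)) -> cylinder A nu `<=` D ->
    has_integral mu D h (\sum_j c j * fine (mu (cylinder A (rcons nu j)))).
  move=> mD nuD; rewrite (funext hc).
  apply: has_integral_sum => // j _; apply: has_integralZ => //.
  have sub : cylinder A (rcons nu j) `<=` cylinder A nu.
    by apply: subset_cylinder; exact: prefix_rcons.
  apply: has_integral_indic => //; first exact: measurable_cylinder.
    exact: subset_trans nuD.
  (* [rcons nu j] may be inadmissible, so finiteness comes from the larger cylinder of [nu]. *)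
  rewrite fineK// ge0_fin_numE//.
  apply: (@le_lt_trans _ _ (mu (cylinder A nu))).
    by apply: le_measure => //; rewrite inE; exact: measurable_cylinder.
  rewrite -[X in cylinder A X]take_size parry_take ?ltry// leqnn.
  by rewrite (leq_trans beta0).
have [_] := intD _ (measurable_cylinder nu) (fun=> id).
rewrite (wavelet_mean0 hW) => ->.
by apply: intD; [exact: measurable_cylinder | exact: subset_cylinder].
Qed.

(** The [p]-th difference of indicators detects the words that leave [nu] first at position [p],
    where the kernel is [lmax ^+ p]. On the cylinder of [nu] these differences vanish and the kernel
    is [lmax ^+ m] wherever [h x] and [h y] differ. *)
Lemma laplacian_integrand h x y : wavelet mu nu h ->
  cylinder A nu x -> cylinder A beta y ->
  (h x - h y) / (dist lam x y `^ dimension lmax lam) =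
  lmax ^+ m * h x * \1_(cylinder A nu) y + - lmax ^+ m * h y +
  h x * \sum_(size beta <= p < m) lmax ^+ p *
    (\1_(cylinder A (take p nu)) y + -1 * \1_(cylinder A (take p.+1 nu)) y).
Proof.
move=> hW xnu ybeta.
have [Sx xl] := (cylinder_nth _ _ _).1 xnu.
have [Sy yb] := (cylinder_nth _ _ _).1 ybeta.
have [ynu|ynu] := pselect (cylinder A nu y).
  have [_ yl] := (cylinder_nth _ _ _).1 ynu.
  rewrite [X in _ + _ * X]big_nat big1 => [|p /andP[_ pm]]; last first.
    rewrite !indicE !mem_set ?mulr1 ?addrN ?mulr0//.
      by apply/cylinder_take => //; split=> // i ip; rewrite yl// (leq_trans ip).
    apply/cylinder_take; first exact: ltnW.
    by split=> // i ip; rewrite yl// (ltn_trans ip).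
  rewrite mulr0 addr0 indicE mem_set// mulr1 mulNr -mulrBr.
  (* If [x] and [y] also agree at position [m], both sides vanish whatever the distance, even for
     [x = y]. *)
  have [xym|xym] := eqVneq (x m) (y m).
    suff -> : h x = h y by rewrite subrr mul0r mulr0.
    apply: (wavelet_const hW (eta := rcons nu (y m))).
    - by rewrite size_rcons addn1.
    - exact/cylinder_rcons.
    - exact/cylinder_rcons.
  rewrite (dist_dimensionV lmax1 lam1 xym) 1?mulrC// => i im.
  by rewrite xl// yl.
rewrite (wavelet_supp hW ynu) subr0 indicE memNset// !mulr0 !add0r.
have [k xyk kmin] : exists2 k, x k != y k & forall i, (i < k)%N -> x i = y i.
  have e : exists k, x k != y k.
    apply: contrapT => /forallNP xy; apply: ynu.
    suff -> : y = x by [].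
    by apply/funext => i; apply/esym/eqP/negPn/negP; exact: xy.
  case: (ex_minnP e) => k xyk kmin; exists k => // i ik.
  by apply/eqP; apply: contraTT ik => /kmin; rewrite -leqNgt.
have bk : (size beta <= k)%N.
  rewrite leqNgt; apply/negP => kb; move/eqP: xyk; apply.
  rewrite xl ?(leq_trans kb)// yb// [in RHS]beta_take nth_take//.
have km : (k < m)%N.
  rewrite ltnNge; apply/negP => mk; apply: ynu; apply/cylinder_nth; split=> // i im.
  by rewrite -kmin ?xl// (leq_trans im).
(* As [x] follows [nu], the point [y] follows [nu] exactly up to position [k]; only the summand
   [p = k] survives. *)
have take_k p : (p <= m)%N ->
    \1_(cylinder A (take p nu)) y = (p <= k)%N%:R :> R.
  move=> pm; rewrite indicE; congr (_%:R); congr nat_of_bool.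
  apply/idP/idP => [/set_mem/cylinder_take[]// _ yp|pk].
    rewrite leqNgt; apply/negP => kp; move/eqP: xyk; apply.
    by rewrite yp// xl// (leq_trans kp).
  apply/mem_set/cylinder_take => //; split=> // i ip.
  by rewrite -kmin ?(leq_trans ip)// xl// (leq_trans ip).
rewrite (dist_dimensionV lmax1 lam1 xyk kmin); congr (_ * _).
rewrite (bigD1_seq k) ?mem_index_iota ?bk ?iota_uniq//=.
rewrite !take_k//; last exact: ltnW.
rewrite leqnn ltnn mulr0 addr0 mulr1 big_seq_cond big1 ?addr0// => p.
rewrite mem_index_iota => /andP[/andP[bp pm] pk].
rewrite !take_k//; last exact: ltnW.
by rewrite leq_eqVlt (negbTE pk)/= mulN1r addrN mulr0.
Qed.

(** The eigenvalue equation is read at a point with [h x != 0]: the integrand is integrated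
    termwise, the wavelet contributes 0, and [h x] cancels. *)
Lemma laplacian_eigenvalueE ell : laplacian_eigenvalue lmax mu lam beta nu ell ->
  ell = lmax * v (l 0%N) 0 * u (l m.-1) 0 + lmax * v (l 0%N) 0 * excess.
Proof.
move=> [h [hW hE]]; have [x hx] := wavelet_neq0 hW.
have xnu : cylinder A nu x.
  by apply: contrapT => /(wavelet_supp hW) hx0; rewrite hx0 eqxx in hx.
have mbeta := @measurable_cylinder R n A beta.
have := hE x (subset_cylinder beta_nu xnu); rewrite /laplacian => hxE.
pose f : path_space A -> R := fun y =>
  lmax ^+ m * h x * \1_(cylinder A nu) y + - lmax ^+ m * h y +
  h x * \sum_(size beta <= p < m) lmax ^+ p *
    (\1_(cylinder A (take p nu)) y + -1 * \1_(cylinder A (take p.+1 nu)) y).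
have fint : has_integral mu (cylinder A beta) f
  (lmax ^+ m * h x * (v (l 0%N) 0 * u (l m.-1) 0 * lmax ^- m.-1) +
   - lmax ^+ m * 0 + h x * \sum_(size beta <= p < m) lmax ^+ p *
   (v (l 0%N) 0 * u (l p.-1) 0 * lmax ^- p.-1 +
    -1 * (v (l 0%N) 0 * u (l p) 0 * lmax ^- p))).
  apply: has_integralD => //.
    apply: has_integralD => //; apply: has_integralZ => //.
      rewrite -[X in \1_(cylinder A X)]take_size.
      by apply: has_integral_cylinder_take; rewrite size_le leqnn.
    exact: has_integral_wavelet.
  apply: has_integralZ => //; under eq_fun do rewrite big_nat.
  rewrite big_nat; apply: has_integral_sum => // p /andP[bp pm].
  apply: has_integralZ => //; apply: has_integralD => //.
    by apply: has_integral_cylinder_take; rewrite bp ltnW.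
  apply: has_integralZ => //; apply: has_integral_cylinder_take.
  by rewrite leqW.
apply: (mulIf hx); rewrite -hxE.
rewrite (eq_Rintegral mu (g := f)) => [|y yb]; last first.
  exact: laplacian_integrand hW xnu (set_mem yb).
(* The exponent in the Parry measure is the length minus one, so one factor [lmax] survives in every
   term. *)
rewrite fint.2 mulr0 addr0 mulrDl; congr (_ + _).
  have -> : lmax ^+ m = lmax * lmax ^+ m.-1.
    by rewrite -exprS prednK// (leq_trans beta0).
  by field; rewrite expf_neq0 ?gt_eqF.
rewrite mulrC; congr (_ * _); rewrite mulr_sumr !big_nat.
apply: eq_bigr => p /andP[bp pm].
have -> : lmax ^+ p = lmax * lmax ^+ p.-1.
  by rewrite -exprS prednK// (leq_trans beta0).
by field; rewrite expf_neq0 ?gt_eqF.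
Qed.

(** Equal cylinders have equal Parry measure, which forces growth of [u] by
    [lmax ^+ (m - size beta)]; Bernoulli's inequality makes this bound linear. *)
Lemma size_le_of_cylinder_eq (umin umax : R) : 0 < umin ->
  (forall i, umin <= u i 0 <= umax) -> (forall i, 0 < v i 0) ->
  cylinder A nu = cylinder A beta ->
  (lmax - 1) * umin * (m - size beta)%:R <= umax.
Proof.
move=> umin0 uP v0 eqC.
have eqmu : u (l m.-1) 0 / lmax ^+ m.-1 =
    u (l (size beta).-1) 0 / lmax ^+ (size beta).-1.
  apply: (mulfI (lt0r_neq0 (v0 (l 0%N)))); rewrite !mulrA; apply: EFin_inj.
  rewrite -!parry_take ?leqnn ?size_le ?beta0 ?(leq_trans beta0)//.
  by rewrite take_size -beta_take eqC.
have u_last : u (l m.-1) 0 = u (l (size beta).-1) 0 * lmax ^+ (m - size beta).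
  have -> : u (l m.-1) 0 = u (l m.-1) 0 / lmax ^+ m.-1 * lmax ^+ m.-1.
    by rewrite divfK// expf_neq0// gt_eqF.
  rewrite eqmu -mulrA; congr (_ * _).
  have -> : m.-1 = ((size beta).-1 + (m - size beta))%N.
    by rewrite -subn1 -[in RHS]subn1 addnBAC// subnKC.
  by rewrite exprD mulKf// expf_neq0// gt_eqF.
have bernoulli k : (lmax - 1) * k%:R <= lmax ^+ k.
  suff : 1 + (lmax - 1) * k%:R <= lmax ^+ k by apply: le_trans; rewrite lerDr.
  elim: k => [|k ih]; first by rewrite mulr0 addr0.
  (* The remaining gap is [(lmax - 1) ^+ 2 * k]. *)
  rewrite exprS; apply: (le_trans _ (ler_wpM2l (ltW lmax0) ih)).
  rewrite -natr1; have := sqr_ge0 (lmax - 1); have := ler0n R k; nra.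
have /andP[_ umaxP] := uP (l m.-1).
have /andP[uminP _] := uP (l (size beta).-1).
apply: (le_trans _ umaxP); rewrite u_last [_ * umin]mulrC -mulrA.
apply: ler_pM => //; first exact: ltW.
by rewrite mulr_ge0// subr_ge0 ltW.
Qed.

(** * Linear bounds on the excess, and its relation to the closed formula *)

Section Excess.
Hypothesis A01 : zero_one A.
Hypothesis uvP : perron_frobenius A lmax u v.
Variables umin umax : R.
Hypothesis uP : forall i, umin <= u i 0 <= umax.

Let letters p : (size beta <= p < m)%N -> A (l p.-1) (l p) = 1.
Proof.
move=> /andP[bp pm]; have p0 : (0 < p)%N by exact: leq_trans bp.
by have /sortedP-/(_ ord0 p.-1) := nuA; rewrite prednK// => /(_ pm)/eqP.
Qed.

(** In [lmax u_i = sum_j A_ij u_j] the summand of an allowed transition is at most the whole sum. *)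
Let excess_term_ge0 p : (size beta <= p < m)%N ->
  0 <= u (l p.-1) 0 - u (l p) 0 / lmax.
Proof.
move=> /letters Ap; rewrite subr_ge0 ler_pdivrMr// mulrC.
have /matrixP/(_ (l p.-1) 0) := pf_right uvP; rewrite !mxE => <-.
rewrite (bigD1 (l p))//= Ap mul1r lerDl sumr_ge0// => j _.
rewrite mulr_ge0//; last exact/ltW/(pf_right_gt0 uvP).
by case: (A01 (l p.-1) j) => ->.
Qed.

Lemma excess_ge0 : 0 <= excess.
Proof. by rewrite /excess big_nat sumr_ge0. Qed.

Lemma excess_le : excess <= umax * (m - size beta)%:R.
Proof.
rewrite mulr_natr -sumr_const_nat /excess; apply: ler_sum_nat => p _.
have /andP[_ uM] := uP (l p.-1); apply: (le_trans _ uM).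
by rewrite gerBl divr_ge0 ?ltW// (pf_right_gt0 uvP).
Qed.

(* Each term times [lmax] is [(lmax - 1) u_(p-1) + (u_(p-1) - u_p)]; the second
   part telescopes to a bounded quantity. *)
Lemma excess_ge : 0 <= umin ->
  (lmax - 1) * umin * (m - size beta)%:R - umax <= lmax * excess.
Proof.
move=> umin0.
have -> : lmax * excess =
    \sum_(size beta <= p < m) (lmax - 1) * u (l p.-1) 0 +
    (u (l (size beta).-1) 0 - u (l m.-1) 0).
  rewrite -[X in _ + X](_ : \sum_(size beta <= p < m)
    (u (l p.-1) 0 - u (l p) 0) = _); last first.
    rewrite (telescope_sumr_eq (fun p => - u (l p.-1) 0))// => [|p _].
      by rewrite opprK addrC.
    by rewrite opprK addrC.
  rewrite -big_split /excess mulr_sumr; apply: eq_bigr => p _ /=.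
  by field; rewrite gt_eqF.
apply: lerD.
  rewrite mulr_natr -sumr_const_nat; apply: ler_sum_nat => p _.
  by rewrite ler_pM2l ?subr_gt0//; have /andP[] := uP (l p.-1).
have /andP[_ uM] := uP (l m.-1).
have /andP[um _] := uP (l (size beta).-1).
by move: umin0 uM um; lra.
Qed.

Lemma lambda_formulaE : cylinder A nu <> cylinder A beta ->
  lambda_formula A lmax u v beta nu = 1 + lmax * v (l 0%N) 0 * excess.
Proof.
move=> neqC; rewrite /lambda_formula; case: asboolP => // _.
(* The closed formula runs through [nu] backwards: its index [k] corresponds to [p = m - k - 1]. *)
congr (_ + _ * _); rewrite /excess -[X in \sum_(X <= _ < _) (_ - _)]add0n.
rewrite big_addn [RHS]big_nat_rev /= add0n !big_nat; apply: eq_bigr => k.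
move=> /andP[_ km]; have p_eq : (m - size beta - k.+1 + size beta = m - k - 1)%N.
  by move: km size_le; clear; lia.
have mk : (size beta <= m - k - 1 < m)%N.
  by move: km size_le beta0; clear; lia.
have := letters mk; rewrite p_eq; have -> : (m - k - 1).-1 = (m - k - 2)%N by clear; lia.
move=> Ap; rewrite /transition Ap.
by field; rewrite !gt_eqF// (pf_right_gt0 uvP).
Qed.

End Excess.

End Spectrum.

(** * Uniform constants and the two-sided bound *)

Lemma pos_fun_bounds (R : realType) (n : nat) (f : 'I_n.+1 -> R) :
  (forall i, 0 < f i) ->
  exists a b, 0 < a /\ forall i, a <= f i <= b.
Proof.
move=> f0; case: (arg_minP f (erefl : predT (ord0 : 'I_n.+1))) => i _ fi.
case: (arg_maxP f (erefl : predT (ord0 : 'I_n.+1))) => j _ fj.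
exists (f i), (f j); split=> // k; apply/andP; split; first exact: fi.
exact: fj.
Qed.

(** The average of the two lower bounds with weights proportional to [c * b] and [e] cancels the
    negative constant; a positive [e * e] is dropped. *)
Lemma linear_lower_bound (R : realFieldType) (e c a b k ell : R) :
  0 < e -> 0 < c -> 0 < b -> e <= ell -> e + c * (a * k - b) <= ell ->
  c * a * e / (e + c * b) * k <= ell.
Proof.
move=> e0 c0 b0 e_ell h; have cb0 : 0 < c * b by rewrite mulr_gt0.
rewrite mulrAC ler_pdivrMr ?addr_gt0//.
have h1 : 0 <= (ell - e) * (c * b) by rewrite mulr_ge0 ?subr_ge0// ltW.
have h2 : 0 <= e * (ell - (e + c * (a * k - b))) by rewrite mulr_ge0 ?subr_ge0// ltW.
have h3 : 0 < e * e by rewrite mulr_gt0.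
move: h1 h2 h3; lra.
Qed.

(* ell ranges over both descriptions of lambda_beta^A(nu): the closed formula
   and the eigenvalue of the Laplacian on the functions h_(nu,j). The upper
   bound excludes nu = beta, where |nu| - |beta| = 0 and the formula is 1. *)
Theorem proposition4p6 (R : realType) (n : nat) (A : 'M[R]_n.+1)
    (lmax : R) (u v : 'cV[R]_n.+1) (lam : R)
    (mu : {measure set (path_space A) -> \bar R}) :
  zero_one A -> primitive A ->
  1 < lmax -> perron_frobenius A lmax u v ->
  1 < lam -> parry_measure lmax u v mu ->
  exists C0 C1 : R, 0 < C0 /\ C0 <= C1 /\
    forall beta nu : word n,
      beta <> [::] -> admissible A beta -> spectral_word A beta nu ->
      forall ell : R,
        ell = lambda_formula A lmax u v beta nu \/
        laplacian_eigenvalue lmax mu lam beta nu ell ->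
        C0 * (size nu - size beta)%:R <= ell /\
        (nu <> beta -> ell <= C1 * (size nu - size beta)%:R).
Proof.
move=> A01 _ lmax1 uvP lam1 muP.
have lmax0 : 0 < lmax := lt_trans ltr01 lmax1.
have [umin [umax [umin0 uP]]] := pos_fun_bounds (pf_right_gt0 uvP).
have [vmin [vmax [vmin0 vP]]] := pos_fun_bounds (pf_left_gt0 uvP).
have umax0 : 0 < umax.
  by have /andP[h1 h2] := uP ord0; exact: lt_le_trans umin0 (le_trans h1 h2).
have vmax0 : 0 < vmax.
  by have /andP[h1 h2] := vP ord0; exact: lt_le_trans vmin0 (le_trans h1 h2).
(* [e] lies below both possible constant terms, 1 and [lmax v_1 u_(m-1)]. *)
pose a := (lmax - 1) * umin; pose e := Num.min 1 (lmax * vmin * umin).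
have a0 : 0 < a by rewrite mulr_gt0 ?subr_gt0.
have e0 : 0 < e by rewrite lt_min ltr01 !mulr_gt0.
pose C0 := vmin * a * e / (e + vmin * umax).
have C00 : 0 < C0 := divr_gt0 (mulr_gt0 (mulr_gt0 vmin0 a0) e0)
  (addr_gt0 e0 (mulr_gt0 vmin0 umax0)).
pose M := lmax * vmax * umax; have M0 : 0 < M by rewrite !mulr_gt0.
(* The summand [C0] only secures [C0 <= C1]; for [k >= 1] the constant [1 + M] is absorbed into
   [(1 + M) * k]. *)
exists C0, (C0 + (1 + M + M)); split=> //; split; first by rewrite lerDl; lra.
move=> beta nu beta_nil _ [beta_nu nuA _] ell ellP.
have beta0 : (0 < size beta)%N by rewrite lt0n size_eq0; exact/eqP.
set k : R := (size nu - size beta)%:R.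
have k0 : 0 <= k by exact: ler0n.
suff [e_ell lower upper] : [/\ e <= ell, e + vmin * (a * k - umax) <= ell &
    ell <= 1 + M + M * k].
  split; first exact: linear_lower_bound.
  move=> nu_beta; have k1 : 1 <= k.
    rewrite ler1n subn_gt0 ltn_neqAle (size_prefix beta_nu) andbT.
    apply/negP => /eqP eqs; apply: nu_beta.
    by move: beta_nu; rewrite prefixE eqs take_size => /eqP.
  have h1 : 0 <= C0 * k by rewrite mulr_ge0// ltW.
  have h2 : 0 <= (1 + M) * (k - 1) by rewrite mulr_ge0 ?subr_ge0//; lra.
  by move: h1 h2; lra.
(* Only the closed formula has an exceptional case: there the value is 1, and [a * k <= umax] makes
   the lower bound hold. *)
have [eqC|neqC] := pselect (cylinder A nu = cylinder A beta /\
    ell = lambda_formula A lmax u v beta nu).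
  have ell1 : ell = 1.
    by rewrite eqC.2 /lambda_formula; case: asboolP => // /(_ eqC.1).
  have e1 : e <= 1 by rewrite ge_min lexx.
  have ak : a * k - umax <= 0.
    rewrite subr_le0.
    exact: (size_le_of_cylinder_eq lmax1 muP beta0 beta_nu nuA umin0 uP (pf_left_gt0 uvP) eqC.1).
  have vak := mulr_ge0_le0 (ltW vmin0) ak.
  have Mk0 : 0 <= M * k by rewrite mulr_ge0// ltW.
  by split; move: vak e1 M0 Mk0 ell1; lra.
have [c cP ->] : exists2 c, e <= c <= 1 + M &
    ell = c + v (nth ord0 nu 0%N) 0 * (lmax * excess lmax u beta nu).
  case: ellP => [ellE|/(laplacian_eigenvalueE lmax1 lam1 muP beta0 beta_nu nuA)].
    exists 1; first by rewrite ge_min lexx /= lerDl ltW.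
    rewrite {1}ellE (lambda_formulaE lmax1 beta0 beta_nu nuA uvP); first by ring.
    by move=> eqC; apply: neqC.
  set c := lmax * _ * _ => ->; exists c; last by ring.
  have /andP[v1 v2] := vP (nth ord0 nu 0%N).
  have /andP[u1 u2] := uP (nth ord0 nu (size nu).-1).
  have lv0 : 0 <= lmax * vmin by rewrite mulr_ge0 ?ltW.
  apply/andP; split.
    rewrite ge_min; apply/orP; right.
    by apply: ler_pM => //; [exact: ltW|rewrite ler_pM2l].
  apply: (@le_trans _ _ M); last by rewrite lerDr.
  apply: ler_pM; rewrite ?ler_pM2l//.
    by rewrite mulr_ge0 ?ltW// (pf_left_gt0 uvP).
  by rewrite ltW// (pf_right_gt0 uvP).
have /andP[e_c c_M] := cP.
have /andP[v1 v2] := vP (nth ord0 nu 0%N).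
have S0 := excess_ge0 lmax1 beta0 nuA A01 uvP.
have Sle := excess_le lmax1 beta nu uvP uP.
have Sge := excess_ge lmax1 beta_nu uP (ltW umin0).
set S := excess lmax u beta nu in S0 Sle Sge *; set w := v _ _ in v1 v2 *.
have lS0 : 0 <= lmax * S := mulr_ge0 (ltW lmax0) S0.
split.
- by rewrite (le_trans e_c)// lerDl mulr_ge0// (le_trans (ltW vmin0)).
(* [a * k - umax] may be negative, so [vmin] is compared with [w] on the nonnegative factor
   [lmax * S]. *)
- apply: lerD => //; apply: (@le_trans _ _ (vmin * (lmax * S))).
    by rewrite ler_pM2l.
  exact: ler_wpM2r.
- apply: lerD => //; have -> : M * k = vmax * (lmax * (umax * k)).
    by rewrite /M; ring.
  apply: ler_pM => //; first exact: le_trans (ltW vmin0) v1.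
  by rewrite ler_pM2l.
Qed.
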